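(* Let $(M_{0:n},G_{0:n})$ be a Feynman--Kac model on a measurable space $(\mathsf X,\mathcal X)$ with terminal time $n\ge 1$, and let $\omega_{0:n}$, $\varrho_{0:n}$ and $\psi_{0:n}$ be three sequences of twisting functions for it, such that $\sup_{x\in\mathsf X}\omega_p(x)\varrho_p(x)^{-1}=1$ for every $p\in\{0,\dots,n\}$. For each $p$ consider the rejection sampler for $M_p^{\omega}$ which uses $M_p^{\varrho}$ as the proposal distribution. Its average acceptance rate at time $p$ within the $\omega$-twisted model $(M_{0:n}^{\omega},G_{0:n}^{\omega})$ is defined as $$\alpha_0^{\omega,\varrho}:=M_0^{\varrho}(\omega_0/\varrho_0),\qquad \alpha_p^{\omega,\varrho}:=\hat\eta_{p-1}^{\omega}M_p^{\varrho}(\omega_p/\varrho_p)=\int_{\mathsf X}\hat\eta_{p-1}^{\omega}(\mathrm dx)\,M_p^{\varrho}(\omega_p/\varrho_p)(x),\quad p\in\{1,\dots,n\}.$$ Then $$\alpha_0^{\omega,\varrho}=\frac{M_0(\omega_0)}{M_0(\varrho_0)},$$ and these rates can be written with respect to the $\psi$-twisted model $(M_{0:n}^{\psi},G_{0:n}^{\psi})$ as $$\alpha_p^{\omega,\varrho}=\frac{\hat\eta_{p-1}^{\psi}\left[M_p(\omega_p)^2/\{M_p(\psi_p)\cdot M_p(\varrho_p)\}\right]}{\hat\eta_{p-1}^{\psi}\{M_p(\omega_p)/M_p(\psi_p)\}},\qquad p\in\{1,\dots,n\}.$$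
   Context: Notation: for a measure $\mu$, a non-negative kernel $K$ and a measurable function $f$ on $(\mathsf X,\mathcal X)$, $\mu(f)=\int f\,\mathrm d\mu$, $K(f)(z)=\int f(x)K(z,\mathrm dx)$, and $\mu K(S)=\int\mu(\mathrm dx)K(x,S)$. Products and quotients of functions are pointwise. A Feynman--Kac model $(M_{0:n},G_{0:n})$ on $(\mathsf X,\mathcal X)$ consists of a probability measure $M_0$, Markov kernels $M_1,\dots,M_n$ on $(\mathsf X,\mathcal X)$ and measurable potential functions $G_p:\mathsf X\to(0,\infty)$, $p\in\{0,\dots,n\}$. Its predictive marginal measures are $\gamma_0=M_0$ and $\gamma_p(S)=\int_{\mathsf X}\gamma_{p-1}(\mathrm dx)G_{p-1}(x)M_p(x,S)$ for $p\in\{1,\dots,n\}$; its updated marginal measures are $\hat\gamma_p(S)=\int_S\gamma_p(\mathrm dx)G_p(x)$ for $p\in\{0,\dots,n\}$. The associated probability distributions are $\eta_p=\gamma_p/\gamma_p(\mathsf X)$ and $\hat\eta_p=\hat\gamma_p/\hat\gamma_p(\mathsf X)$; the total masses $\gamma_p(\mathsf X)$ and $\hat\gamma_p(\mathsf X)$ are finite (this is implicit in the normalisation). Twisting functions are measurable functions $\psi_p:\mathsf X\to(0,\infty)$, $p\in\{0,\dots,n\}$, such that $M_p(\psi_p)$ is bounded for each $p$ (for $p=0$, $M_0(\psi_0)<\infty$). The $\psi$-twisted model $(M^\psi_{0:n},G^\psi_{0:n})$ is the Feynman--Kac model with $$M_0^\psi(\mathrm dx_0)=\frac{M_0(\mathrm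 dx_0)\psi_0(x_0)}{M_0(\psi_0)},\qquad M_p^\psi(x_{p-1},\mathrm dx_p)=\frac{M_p(x_{p-1},\mathrm dx_p)\psi_p(x_p)}{M_p(\psi_p)(x_{p-1})},\quad p\in\{1,\dots,n\},$$ $$G_0^\psi(x_0)=\frac{G_0(x_0)}{\psi_0(x_0)}M_1(\psi_1)(x_0)M_0(\psi_0),\quad G_p^\psi(x_p)=\frac{G_p(x_p)}{\psi_p(x_p)}M_{p+1}(\psi_{p+1})(x_p)\ (1\le p\le n-1),\quad G_n^\psi(x_n)=\frac{G_n(x_n)}{\psi_n(x_n)}.$$ Objects of the $\psi$-twisted model carry the superscript $\psi$: $\gamma_p^\psi,\hat\gamma_p^\psi,\eta_p^\psi,\hat\eta_p^\psi$; similarly for $\omega$ and $\varrho$. The rejection sampler draws independent proposals $X'\sim M_p^\varrho(x_{p-1},\cdot)$ (or $X'\sim M_0^\varrho$ when $p=0$) and accepts the first one for which an independent uniform variable on $[0,1]$ is smaller than $\omega_p(X')/\varrho_p(X')$; hence its acceptance probability given $x_{p-1}$ is $M_p^\varrho(\omega_p/\varrho_p)(x_{p-1})$. *)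

(* Defs.v *)
From HB Require Import structures.
From mathcomp Require Import all_boot all_order all_algebra.
From mathcomp Require Import all_classical all_reals all_analysis.
From mathcomp Require Import measurable_realfun.

Set Implicit Arguments.
Unset Strict Implicit.
Unset Printing Implicit Defensive.

Import Order.TTheory GRing.Theory Num.Theory.
Import numFieldNormedType.Exports.

Local Open Scope classical_set_scope.
Local Open Scope ring_scope.
Local Open Scope ereal_scope.

Record posfun d (T : measurableType d) (R : realType) := PosFun {
  posfun_fun :> T -> R ;
  posfun_measurable : measurable_fun [set: T] posfun_fun ;
  posfun_gt0 : forall x, (0 < posfun_fun x)%R }.

Section posfun_lemmas.
Context d (T : measurableType d) (R : realType).

Lemma posfun_emeasurable (f : posfun T R) (D : set T) :
  measurable_fun D (fun x => (f x)%:E).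
Proof.
by apply/measurable_EFinP; exact: measurable_funTS (posfun_measurable f).
Qed.

Lemma posfun_ege0 (f : posfun T R) x : 0 <= (f x)%:E.
Proof. by rewrite lee_fin ltW// posfun_gt0. Qed.

Lemma posfun_integral_gt0 (mu : {measure set T -> \bar R}) (f : posfun T R) :
  mu [set: T] = 1 -> 0 < \int[mu]_x (f x)%:E.
Proof.
move=> mu1.
rewrite lt_def integral_ge0 ?andbT; last by move=> x _; exact: posfun_ege0.
apply/negP => /eqP i0.
have : \int[mu]_x `|(f x)%:E| = 0.
  rewrite -[RHS]i0; apply: eq_integral => x _.
  by rewrite gee0_abs// posfun_ege0.
have mf : measurable_fun [set: T] (fun x => (f x)%:E).
  exact: posfun_emeasurable.
move=> /(ae_eq_integral_abs _ measurableT mf).1.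
move=> [A [mA A0 sub]].
have AT : A = [set: T].
  apply/seteqP; split => // x _; apply: sub => /= /(_ Logic.I) /eqP.
  by rewrite eqe gt_eqF// posfun_gt0.
move: mu1; rewrite -AT A0 => /eqP.
by rewrite eq_sym onee_eq0.
Qed.

End posfun_lemmas.

Section mdensity.
Context d (T : measurableType d) (R : realType).
Variables (mu : {measure set T -> \bar R}) (g : posfun T R).

Definition mdensity (S : set T) : \bar R := \int[mu]_(x in S) (g x)%:E.

Let mdensity0 : mdensity set0 = 0.
Proof. by rewrite /mdensity integral_set0. Qed.

Let mdensity_ge0 S : 0 <= mdensity S.
Proof. by apply: integral_ge0 => x _; exact: posfun_ege0. Qed.

Let mdensity_sigma_additive : semi_sigma_additive mdensity.
Proof.
apply: semi_sigma_additive_nng_induced; first exact: posfun_emeasurable.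
by move=> x; exact: posfun_ege0.
Qed.

HB.instance Definition _ := isMeasure.Build _ _ _ mdensity
  mdensity0 mdensity_ge0 mdensity_sigma_additive.

End mdensity.

Section kdensity.
Context d (T : measurableType d) (R : realType).
Variables (K : R.-pker T ~> T) (g : posfun T R).

Definition kdensity : T -> {measure set T -> \bar R} :=
  fun z => mdensity (K z) g.

Let measurable_kdensity S :
  measurable S -> measurable_fun [set: T] (kdensity ^~ S).
Proof.
move=> mS; rewrite /kdensity /= /mdensity.
under eq_fun do rewrite integral_mkcond.
apply: measurable_fun_integral_kernel.
- exact: measurable_kernel.
- by apply: erestrict_ge0 => x _; exact: posfun_ege0.
- by apply/(measurable_restrictT _ _).1 => //; exact: posfun_emeasurable.
Qed.

HB.instance Definition _ :=
  isKernel.Build _ _ _ _ R kdensity measurable_kdensity.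

End kdensity.

Section fkstep.
Context d (T : measurableType d) (R : realType).
Variables (mu : {measure set T -> \bar R}) (g : posfun T R)
  (K : R.-pker T ~> T).

Definition fkstep (S : set T) : \bar R := \int[mu]_x ((g x)%:E * K x S).

Let fkstep0 : fkstep set0 = 0.
Proof. by apply: integral0_eq => x _; rewrite measure0 mule0. Qed.

Let fkstep_ge0 S : 0 <= fkstep S.
Proof.
by apply: integral_ge0 => x _; rewrite mule_ge0// posfun_ege0.
Qed.

Let fkstep_sigma_additive : semi_sigma_additive fkstep.
Proof.
move=> U mU tU mUU; rewrite [X in _ --> X](_ : _ =
  \int[mu]_x (\sum_(n <oo) ((g x)%:E * K x (U n)))); last first.
  apply: eq_integral => x _; rewrite nneseriesZl//; congr (_ * _).
  by apply/esym/cvg_lim => //; exact: measure_semi_sigma_additive.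
apply/cvg_closeP; split.
  by apply: is_cvg_nneseries => n _ _; exact: fkstep_ge0.
rewrite closeE// integral_nneseries//.
- move=> n; apply: emeasurable_funM; first exact: posfun_emeasurable.
  exact: measurable_kernel.
- by move=> n x _; rewrite mule_ge0// posfun_ege0.
Qed.

HB.instance Definition _ := isMeasure.Build _ _ _ fkstep
  fkstep0 fkstep_ge0 fkstep_sigma_additive.

End fkstep.

Definition kint d (T : measurableType d) (R : realType)
    (K : R.-pker T ~> T) (f : T -> R) (z : T) : \bar R :=
  \int[K z]_x (f x)%:E.

(* Sequences are indexed by nat. For a terminal time n only the potentials at
   times 0..n and the kernels at times 1..n are meaningful; in particular the
   entry [fkM 0] is never used, the initial law being [fkM0]. Requiring the
   remaining entries to be kernels and positive measurable functions loses no
   generality: pad with Dirac kernels and the constant 1. *)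
Record FKmodel d (T : measurableType d) (R : realType) := MkFKmodel {
  fkM0 : probability T R ;
  fkM : nat -> R.-pker T ~> T ;
  fkG : nat -> posfun T R }.

Section FeynmanKac.
Context d (T : measurableType d) (R : realType).
Implicit Type F : FKmodel T R.

Fixpoint gamma F (p : nat) : {measure set T -> \bar R} :=
  match p with
  | 0%N => fkM0 F
  | q.+1 => fkstep (gamma F q) (fkG F q) (fkM F q.+1)
  end.

Definition gammahat F (p : nat) : {measure set T -> \bar R} :=
  mdensity (gamma F p) (fkG F p).

Definition fk_finite (n : nat) F : Prop :=
  forall p, (p <= n)%N ->
    gamma F p [set: T] < +oo /\ gammahat F p [set: T] < +oo.

(* [mnormalize] falls back on its second argument only when the total mass is 0
   or +oo; the former is impossible here, as potentials are positive. *)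
Definition etahat F (p : nat) : probability T R :=
  mnormalize (gammahat F p) (fkM0 F).

Record twisting (n : nat) F := Twisting {
  twist_fun :> nat -> posfun T R ;
  twist_init : \int[fkM0 F]_x (twist_fun 0%N x)%:E < +oo ;
  twist_bounded : forall p, (1 <= p <= n)%N ->
    exists C : R, forall x, kint (fkM F p) (twist_fun p) x <= C%:E }.

End FeynmanKac.

Section twisted.
Context d (T : measurableType d) (R : realType) (n : nat).
Variables (F : FKmodel T R) (psi : twisting n F).

(* The normalising constants of [mnormalize] and [knormalize] are the total
   masses M_0(psi_0) and M_p(psi_p)(z), which lie in ]0, +oo[ for p <= n; the
   fallback law is therefore never used at these times. *)
Definition twistedM0 : probability T R :=
  mnormalize (mdensity (fkM0 F) (psi 0%N)) (fkM0 F).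

Definition twistedM (p : nat) : R.-pker T ~> T :=
  knormalize (kdensity (fkM F p) (psi p)) (fkM0 F).

Definition twistedG_fun (p : nat) (x : T) : R :=
  (fkG F p x / psi p x
   * (if (p < n)%N then fine (kint (fkM F p.+1) (psi p.+1) x) else 1)
   * (if p == 0%N then fine (\int[fkM0 F]_y (psi 0%N y)%:E) else 1))%R.

Lemma measurable_twistedG p : measurable_fun [set: T] (twistedG_fun p).
Proof.
apply: measurable_funM; last exact: measurable_cst.
apply: measurable_funM.
  apply: measurable_funM; first exact: posfun_measurable.
  apply: (measurable_comp (F := [set r : R | r != 0%R])).
  - by apply: open_measurable; exact: open_neq.
  - by move=> _ [x _ <-] /=; rewrite gt_eqF// posfun_gt0.
  - apply: open_continuous_measurable_fun; first exact: open_neq.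
    by apply/in_setP => x /= x0; exact: inv_continuous.
  - exact: posfun_measurable.
have [pn|pn] := boolP (p < n)%N; last exact: measurable_cst.
apply: measurableT_comp => //; apply: measurable_fun_integral_kernel.
- exact: measurable_kernel.
- by move=> x; exact: posfun_ege0.
- exact: posfun_emeasurable.
Qed.

Lemma twistedG_gt0 p x : (0 < twistedG_fun p x)%R.
Proof.
apply: mulr_gt0; last first.
  case: ifPn => // _; apply: fine_gt0.
  rewrite twist_init andbT; apply: posfun_integral_gt0.
  exact: (probability_setT (fkM0 F)).
apply: mulr_gt0; first by rewrite divr_gt0// posfun_gt0.
case: ifPn => // pn; apply: fine_gt0.
have [C /(_ x) hC] := @twist_bounded _ _ _ _ _ psi p.+1 pn.
apply/andP; split; last exact: le_lt_trans hC (ltry _).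
by apply: posfun_integral_gt0; exact: prob_kernel.
Qed.

Definition twistedG (p : nat) : posfun T R :=
  PosFun (measurable_twistedG p) (twistedG_gt0 p).

Definition twisted : FKmodel T R := MkFKmodel twistedM0 twistedM twistedG.

End twisted.

Section acceptance.
Context d (T : measurableType d) (R : realType) (n : nat).
Variables (F : FKmodel T R) (omega rho : twisting n F).

Definition acceptance_rate (p : nat) : \bar R :=
  match p with
  | 0%N => \int[fkM0 (twisted rho)]_x (omega 0%N x / rho 0%N x)%:E
  | q.+1 => \int[etahat (twisted omega) q]_x
              kint (fkM (twisted rho) q.+1)
                (fun y => omega q.+1 y / rho q.+1 y)%R x
  end.

End acceptance.

(* Main.v *)
(* Twisting changes a marginal only through its last look-ahead factor:
   gammahat^psi_q (dx) = M_{q+1}(psi_{q+1})(x) gammahat_q (dx). Also, the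
   acceptance probability given x is M_{q+1}(omega_{q+1})(x) /
   M_{q+1}(rho_{q+1})(x), because rho * (omega / rho) = omega. Hence both sides
   equal gammahat_q (M(omega)^2 / M(rho)) / gammahat_q (M(omega)). *)
Require Import Defs.
From mathcomp Require Import all_boot all_order all_algebra.
From mathcomp Require Import all_classical all_reals all_analysis.
From mathcomp Require Import measurable_realfun.
From mathcomp Require Import ring.

Set Implicit Arguments.
Unset Strict Implicit.
Unset Printing Implicit Defensive.

Import Order.TTheory GRing.Theory Num.Theory.

Local Open Scope classical_set_scope.
Local Open Scope ring_scope.
Local Open Scope ereal_scope.

(** * Integration against a mixture of measures *)

Section mixture.
Context d d' (X : measurableType d) (Y : measurableType d') (R : realType).
Variables (mu : {measure set X -> \bar R}) (k : X -> {measure set Y -> \bar R})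
  (nu : {measure set Y -> \bar R}).
Hypothesis mk : forall U, measurable U -> measurable_fun [set: X] (k ^~ U).
Hypothesis nuE : forall U, measurable U -> nu U = \int[mu]_x k x U.

Import HBNNSimple.

Let integral_mixture_nnsfun (f : {nnsfun Y >-> R}) :
  \int[nu]_y (f y)%:E = \int[mu]_x \int[k x]_y (f y)%:E.
Proof.
under [RHS]eq_integral do rewrite integralT_nnsfun sintegralE.
rewrite integralT_nnsfun sintegralE ge0_integral_fsum//.
- apply: eq_fsbigr => r _; rewrite nuE//.
  (* The level [r] is an arbitrary real here; a negative one has an empty preimage, so both sides
     vanish. *)
  have [r0|r0] := leP 0%R r; last first.
    rewrite preimage_nnfun0//.
    rewrite [in RHS]integral0_eq => [|x _]; last by rewrite measure0 mule0.
    by rewrite integral0_eq ?mule0// => x _; rewrite measure0.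
  by rewrite ge0_integralZl//; exact: mk.
- by move=> r; apply: measurable_funeM; exact: mk.
- move=> r x _; have [r0|r0] := leP 0%R r; first by rewrite mule_ge0.
  by rewrite preimage_nnfun0// measure0 mule0.
Qed.

(** Linearity carries [nuE] from sets to simple functions, and monotone convergence, applied under
    [k x] and then under [mu], reaches [f]. Since [k] is a bare family of measures, weights given by
    unbounded densities are covered. *)
Lemma integral_mixture (f : Y -> \bar R) : (forall y, 0 <= f y) ->
  measurable_fun [set: Y] f -> \int[nu]_y f y = \int[mu]_x \int[k x]_y f y.
Proof.
move=> f0 mf; pose f_ := nnsfun_approx measurableT mf.
have mf_ i : measurable_fun [set: Y] (fun y => (f_ i y)%:E).
  exact/measurable_EFinP.
have f_0 i y : 0 <= (f_ i y)%:E by rewrite lee_fin.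
have nd_f_ y : {homo (fun i => (f_ i y)%:E) : a b / (a <= b)%N >-> a <= b}.
  by move=> a b ab; rewrite lee_fin; exact/lefP/nd_nnsfun_approx.
have fE (m : {measure set Y -> \bar R}) :
    \int[m]_y f y = limn (fun i => \int[m]_y (f_ i y)%:E).
  rewrite -monotone_convergence//; apply: eq_integral => y _.
  by apply/esym/cvg_lim => //; exact: cvg_nnsfun_approx.
rewrite fE; under [RHS]eq_integral do rewrite fE.
rewrite monotone_convergence//.
- by congr (limn _); apply/funext => i; exact: integral_mixture_nnsfun.
- by move=> i; exact: measurable_fun_integral_kernel.
- by move=> i x _; exact: integral_ge0.
- move=> x _ a b ab; apply: ge0_le_integral => // y _.
  exact: nd_f_.
Qed.

End mixture.

(** * Integrals against weighted, transported and normalised measures *)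

Section integration.
Context d (T : measurableType d) (R : realType).
Implicit Types (mu : {measure set T -> \bar R}) (g : posfun T R)
  (K : R.-pker T ~> T) (f : T -> \bar R).

Let weight g x : {nonneg R} := NngNum (ltW (posfun_gt0 g x)).

(** A measure with density [g] is the mixture over [mu] of the point masses $g(x)\delta_x$. *)
Lemma integral_mdensity mu g f : (forall x, 0 <= f x) ->
  measurable_fun [set: T] f ->
  \int[mdensity mu g]_x f x = \int[mu]_x ((g x)%:E * f x).
Proof.
move=> f0 mf.
rewrite [LHS](@integral_mixture _ _ _ _ _ mu
  (fun x => mscale (weight g x) (dirac x))) => //.
- apply: eq_integral => x _.
  by rewrite ge0_integral_mscale// integral_dirac// diracT mul1e.
- move=> U mU; apply: emeasurable_funM; first exact: posfun_emeasurable.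
  rewrite (_ : (fun x => _) = EFin \o \1_U); last exact/funext.
  exact/measurable_EFinP.
- move=> U mU; rewrite /= /mdensity integral_mkcond.
  apply: eq_integral => x _; rewrite patchE /mscale/= diracE.
  by case: (x \in U); rewrite ?mule1 ?mule0.
Qed.

(** Here the mixed measures are $g(x)K(x,\cdot)$. *)
Lemma integral_fkstep mu g K f : (forall x, 0 <= f x) ->
  measurable_fun [set: T] f ->
  \int[fkstep mu g K]_y f y = \int[mu]_x ((g x)%:E * \int[K x]_y f y).
Proof.
move=> f0 mf.
rewrite [LHS](@integral_mixture _ _ _ _ _ mu
  (fun x => mscale (weight g x) (K x))) => //.
- by apply: eq_integral => x _; rewrite ge0_integral_mscale.
- move=> U mU; apply: emeasurable_funM; first exact: posfun_emeasurable.
  exact: measurable_kernel.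
Qed.

(** A mass in ]0, +oo[ rules out the fallback [P], leaving a scalar multiple of [mu]. *)
Lemma integral_mnormalize mu (P : probability T R) f :
  0 < mu [set: T] < +oo -> (forall x, 0 <= f x) -> measurable_fun [set: T] f ->
  \int[mnormalize mu P]_x f x = (mu [set: T])^-1 * \int[mu]_x f x.
Proof.
move=> /andP[mu_gt0 mu_lty] f0 mf.
have mu_fin : mu [set: T] \is a fin_num by rewrite ge0_fin_numE.
have c_gt0 : (0 < fine (mu [set: T]))%R by rewrite fine_gt0// mu_gt0.
have c0 : (0 <= (fine (mu [set: T]))^-1)%R by rewrite invr_ge0 ltW.
rewrite [LHS](eq_measure_integral (mscale (NngNum c0) mu)) => [|A mA _].
  by rewrite ge0_integral_mscale//= -[in RHS](fineK mu_fin) inver gt_eqF.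
by rewrite /= /mnormalize gt_eqF// lt_eqF//= muleC.
Qed.


(** On positive reals the inverse is the power of exponent -1, which is measurable on the whole
    line; the pole at 0 is thus avoided. *)
Lemma measurable_posfunV g : measurable_fun [set: T] (fun x => (g x)^-1%R).
Proof.
under eq_fun do rewrite -(powR_inv1 (ltW (posfun_gt0 g _))).
exact: measurableT_comp (measurable_powR _) (posfun_measurable g).
Qed.

(** A zero integral would make [g] vanish almost everywhere, hence the whole space null. Unlike
    [posfun_integral_gt0], this serves the unnormalised marginals. *)
Lemma integral_posfun_gt0 mu g :
  0 < mu [set: T] -> 0 < \int[mu]_x (g x)%:E.
Proof.
move=> mu_gt0; rewrite lt0e integral_ge0 ?andbT => [|x _]; last first.
  exact: posfun_ege0.
apply/eqP => g0.
have mg : measurable_fun [set: T] (EFin \o g) by exact: posfun_emeasurable.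
have : \int[mu]_x `|(EFin \o g) x| = 0.
  by rewrite -g0; apply: eq_integral => x _; rewrite gee0_abs// posfun_ege0.
move=> /(ae_eq_integral_abs mu measurableT mg)[A [mA A0 sub]].
suff AT : A = [set: T] by rewrite -AT A0 ltxx in mu_gt0.
rewrite -subTset => x _; apply: sub => /= /(_ Logic.I) /eqP.
by rewrite eqe gt_eqF// posfun_gt0.
Qed.

End integration.

(** * Positivity of the updated masses *)

Section mass.
Context d (T : measurableType d) (R : realType).
Implicit Type F : FKmodel T R.

(** Markov kernels preserve mass, so $\gamma_{p+1}$ has the mass of $\hat\gamma_p$. *)
Lemma gammahat_gt0 F p : 0 < gammahat F p [set: T].
Proof.
elim: p => [|p IH]; apply: integral_posfun_gt0.
  by rewrite /= (probability_setT (fkM0 F)).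
rewrite /= /fkstep; under eq_integral do rewrite prob_kernel mule1.
exact: IH.
Qed.

End mass.

(** * The means $M_p(\psi_p)$ and the twisted marginals *)

Section twisting_means.
Context d (T : measurableType d) (R : realType) (n : nat) (F : FKmodel T R).
Variable psi : twisting n F.

(** At times 1 to [n] the bound on $M_p(\psi_p)$ excludes +oo, so [fine] loses nothing there. *)
Definition twist_mean p x : R := fine (kint (fkM F p) (psi p) x).

Lemma kint_twist_gt0 p x : 0 < kint (fkM F p) (psi p) x.
Proof. by apply: posfun_integral_gt0; exact: prob_kernel. Qed.

Lemma kint_twist_lty p x : (1 <= p <= n)%N -> kint (fkM F p) (psi p) x < +oo.
Proof.
move=> /(@twist_bounded _ _ _ _ _ psi p)[C /(_ x)] /le_lt_trans; apply.
exact: ltry.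
Qed.

Lemma kint_twistE p x : (1 <= p <= n)%N ->
  kint (fkM F p) (psi p) x = (twist_mean p x)%:E.
Proof.
move=> hp; rewrite fineK// ge0_fin_numE ?kint_twist_lty//.
exact/ltW/kint_twist_gt0.
Qed.

Lemma measurable_twist_mean p : measurable_fun [set: T] (twist_mean p).
Proof.
apply: measurableT_comp => //; apply: measurable_fun_integral_kernel.
- exact: measurable_kernel.
- by move=> x; exact: posfun_ege0.
- exact: posfun_emeasurable.
Qed.

Lemma twist_mean_gt0 p x : (1 <= p <= n)%N -> (0 < twist_mean p x)%R.
Proof. by move=> hp; rewrite -lte_fin -kint_twistE// kint_twist_gt0. Qed.

Definition twist_mean_posfun p (hp : (1 <= p <= n)%N) : posfun T R :=
  PosFun (measurable_twist_mean p) (fun x => twist_mean_gt0 x hp).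

Lemma integral_twistedM0 (f : T -> \bar R) : (forall x, 0 <= f x) ->
  measurable_fun [set: T] f ->
  \int[twistedM0 psi]_x f x = (\int[fkM0 F]_x (psi 0%N x)%:E)^-1 *
    \int[fkM0 F]_x ((psi 0%N x)%:E * f x).
Proof.
move=> f0 mf; rewrite [LHS]integral_mnormalize// ?integral_mdensity//.
rewrite /= /mdensity twist_init andbT; apply: posfun_integral_gt0.
exact: (probability_setT (fkM0 F)).
Qed.

Lemma integral_twistedM p x (f : T -> \bar R) : (1 <= p <= n)%N ->
  (forall y, 0 <= f y) -> measurable_fun [set: T] f ->
  \int[twistedM psi p x]_y f y =
    (twist_mean p x)^-1%:E * \int[fkM F p x]_y ((psi p y)%:E * f y).
Proof.
move=> hp f0 mf; rewrite [LHS]integral_mnormalize//; last first.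
  exact/andP/(conj (kint_twist_gt0 p x))/kint_twist_lty.
rewrite integral_mdensity//; congr (_ * _).
(* The mass of [kdensity] at [x] is $M_p(\psi_p)(x)$ by conversion. *)
transitivity (kint (fkM F p) (psi p) x)^-1; first by [].
by rewrite kint_twistE// inver gt_eqF// twist_mean_gt0.
Qed.

(* The normalisations and the quotients by [psi] telescope along the path,
   leaving only the look-ahead factor of the last potential. *)
Lemma integral_gammahat_twisted q (f : T -> \bar R) : (q < n)%N ->
  (forall x, 0 <= f x) -> measurable_fun [set: T] f ->
  \int[gammahat (twisted psi) q]_x f x =
  \int[gammahat F q]_x ((twist_mean q.+1 x)%:E * f x).
Proof.
elim: q f => [|q IH] f qn f0 mf.
  have tmf : measurable_fun [set: T] (fun x => (twist_mean 1 x)%:E * f x).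
    apply: emeasurable_funM => //.
    exact/measurable_EFinP/measurable_twist_mean.
  have tmf0 x : 0 <= (twist_mean 1 x)%:E * f x.
    by rewrite mule_ge0// lee_fin ltW// twist_mean_gt0.
  rewrite [RHS]integral_mdensity// [LHS]integral_mdensity//.
  rewrite [LHS]integral_twistedM0; last 2 first.
  - by move=> x; rewrite mule_ge0// posfun_ege0.
  - by apply: emeasurable_funM => //; exact: posfun_emeasurable.
  set c := \int[_]_x _.
  have c_gt0 : 0 < c.
    by apply: posfun_integral_gt0; exact: (probability_setT (fkM0 F)).
  have c_fin : c \is a fin_num.
    by rewrite ge0_fin_numE ?ltW//; exact: twist_init.
  (* The constant $c=M_0(\psi_0)$ normalising $M_0^\psi$ is cancelled by the factor [c] inside
     $G_0^\psi$. *)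
  rewrite -[RHS]mul1e -(@mulVe _ c)// ?gt_eqF// -muleA; congr (_ * _).
  rewrite -ge0_integralZl//; last 3 first.
  - by apply: emeasurable_funM => //; exact: posfun_emeasurable.
  - by move=> x _; rewrite mule_ge0// posfun_ege0.
  - exact: ltW.
  apply: eq_integral => x _.
  rewrite !muleA -(fineK c_fin) -!EFinM /= /twistedG_fun qn eqxx.
  congr (_%:E * _).
  rewrite -/(twist_mean 1 x) -/c.
  by have /lt0r_neq0 ? := posfun_gt0 (psi 0%N) x; field.
have hq : (1 <= q.+1 <= n)%N by exact: ltnW.
have hq1 : (1 <= q.+2 <= n)%N by [].
have Gf0 y : 0 <= (twistedG psi q.+1 y)%:E * f y.
  by rewrite mule_ge0// posfun_ege0.
have mGf : measurable_fun [set: T] (fun y => (twistedG psi q.+1 y)%:E * f y).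
  by apply: emeasurable_funM => //; exact: posfun_emeasurable.
have tmf : measurable_fun [set: T] (fun x => (twist_mean q.+2 x)%:E * f x).
  apply: emeasurable_funM => //.
  exact/measurable_EFinP/measurable_twist_mean.
have tmf0 x : 0 <= (twist_mean q.+2 x)%:E * f x.
  by rewrite mule_ge0// lee_fin ltW// twist_mean_gt0.
have Gtmf0 x : 0 <= (fkG F q.+1 x)%:E * ((twist_mean q.+2 x)%:E * f x).
  by rewrite mule_ge0// posfun_ege0.
have mGtmf : measurable_fun [set: T]
    (fun x => (fkG F q.+1 x)%:E * ((twist_mean q.+2 x)%:E * f x)).
  by apply: emeasurable_funM => //; exact: posfun_emeasurable.
have mkernel (K : R.-pker T ~> T) (h : T -> \bar R) : (forall x, 0 <= h x) ->
    measurable_fun [set: T] h ->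
    measurable_fun [set: T] (fun x => \int[K x]_y h y).
  move=> h0 mh; apply: measurable_fun_integral_kernel => //.
  exact: measurable_kernel.
rewrite [LHS]integral_mdensity// [LHS]integral_fkstep//.
(* The weight $G_q^\psi$ is folded back into $\hat\gamma_q^\psi$; the inner integral becomes the
   test function for [IH]. *)
rewrite -[LHS]integral_mdensity; last 2 first.
- by move=> x; apply: integral_ge0.
- exact: mkernel.
rewrite [LHS]IH; last 3 first.
- exact: ltnW.
- by move=> x; apply: integral_ge0.
- exact: mkernel.
rewrite [RHS]integral_mdensity// [RHS]integral_fkstep//.
rewrite -[RHS]integral_mdensity; last 2 first.
- by move=> x; apply: integral_ge0.
- exact: mkernel.
(* The look-ahead factor supplied by [IH] cancels the normalising constant of $M_{q+1}^\psi$. *)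
apply: eq_integral => x _; rewrite integral_twistedM// muleA -EFinM.
rewrite divff ?mul1e ?gt_eqF ?twist_mean_gt0//.
apply: eq_integral => y _; rewrite !muleA -!EFinM /= /twistedG_fun qn/=.
rewrite -/(twist_mean q.+2 y); congr (_%:E * _).
by have /lt0r_neq0 ? := posfun_gt0 (psi q.+1) y; field.
Qed.

End twisting_means.

(** * Twisted updated laws and the acceptance rates *)

(** The constant [c] is the mass of $\hat\gamma_q^\psi$, found by integrating 1. It is finite
    because $M_{q+1}(\psi_{q+1})$ is bounded and $\hat\gamma_q$ has finite mass; being a positive
    real, it can be cancelled freely. *)
Lemma integral_etahat_twisted d (T : measurableType d) (R : realType) (n : nat)
    (F : FKmodel T R) (hF : fk_finite n F) (psi : twisting n F) q :
  (q < n)%N -> exists2 c : R, (0 < c)%R &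
    c%:E = \int[gammahat F q]_x (twist_mean psi q.+1 x)%:E /\
    forall f : T -> \bar R, (forall x, 0 <= f x) ->
      measurable_fun [set: T] f ->
      \int[etahat (twisted psi) q]_x f x =
      c^-1%:E * \int[gammahat F q]_x ((twist_mean psi q.+1 x)%:E * f x).
Proof.
move=> qn; set I := \int[_]_x _.
have massE : gammahat (twisted psi) q [set: T] = I.
  rewrite -[LHS]mul1e -[LHS]integral_cst// integral_gammahat_twisted//.
  by apply: eq_integral => x _; rewrite mule1.
have I_gt0 : 0 < I by rewrite -massE; exact: gammahat_gt0.
have I_lty : I < +oo.
  have [C hC] := @twist_bounded _ _ _ _ _ psi q.+1 qn.
  (* The absolute value makes the majorant visibly non-negative. *)
  apply: (@le_lt_trans _ _ (\int[gammahat F q]_x (cst `|C|%:E x))).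
    apply: ge0_le_integral => //.
    - by move=> x _; rewrite lee_fin ltW// twist_mean_gt0.
    - exact/measurable_EFinP/measurable_twist_mean.
    - move=> x _; rewrite -kint_twistE//.
      by apply: le_trans (hC x) _; rewrite lee_fin ler_norm.
  rewrite integral_cst//; apply: lte_mul_pinfty => //.
  by have [] := hF q (ltnW qn).
have IE : (fine I)%:E = I by rewrite fineK// ge0_fin_numE// ltW.
have fI_gt0 : (0 < fine I)%R by rewrite -lte_fin IE.
exists (fine I) => //; split=> // f f0 mf.
rewrite [LHS]integral_mnormalize//; last by rewrite massE I_gt0.
rewrite integral_gammahat_twisted//; congr (_ * _).
transitivity I^-1; first by congr (_^-1).
by rewrite -[in LHS]IE inver gt_eqF.
Qed.

Theorem proposition3p1 (d : measure_display) (T : measurableType d)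
    (R : realType) (n : nat) (hn : (1 <= n)%N) (F : FKmodel T R)
    (hF : fk_finite n F) (omega rho psi : twisting n F)
    (hsup : forall p, (p <= n)%N ->
      ereal_sup (range (fun x : T => (omega p x / rho p x)%:E)) = 1) :
  acceptance_rate omega rho 0 =
    (\int[fkM0 F]_x (omega 0%N x)%:E) / (\int[fkM0 F]_x (rho 0%N x)%:E)
  /\ forall p, (1 <= p <= n)%N ->
    acceptance_rate omega rho p =
      (\int[etahat (twisted psi) p.-1]_x
         (kint (fkM F p) (omega p) x ^+ 2
          / (kint (fkM F p) (psi p) x * kint (fkM F p) (rho p) x)))
      / (\int[etahat (twisted psi) p.-1]_x
           (kint (fkM F p) (omega p) x / kint (fkM F p) (psi p) x)).
Proof.
have ratio0 p y : 0 <= (omega p y / rho p y)%:E.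
  by rewrite lee_fin divr_ge0// ltW// posfun_gt0.
have mratio p : measurable_fun [set: T] (fun y => (omega p y / rho p y)%:E).
  apply/measurable_EFinP; apply: measurable_funM (measurable_posfunV _).
  exact: posfun_measurable.
have rhoK p y : (rho p y)%:E * (omega p y / rho p y)%:E = (omega p y)%:E.
  by rewrite -EFinM mulrC divfK// gt_eqF// posfun_gt0.
split.
  rewrite /= integral_twistedM0// muleC; congr (_ / _).
  exact: eq_integral.
case=> // q hp; have qn : (q < n)%N by [].
rewrite /=.
set w := twist_mean_posfun omega hp; set r := twist_mean_posfun rho hp.
set s := twist_mean_posfun psi hp.
have kE (t : twisting n F) x :
    kint (fkM F q.+1) (t q.+1) x = (twist_mean_posfun t hp x)%:E.
  exact: kint_twistE.
have ratE x : kint (twistedM rho q.+1) (fun y => omega q.+1 y / rho q.+1 y)%R x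
    = (w x / r x)%:E.
  rewrite /kint integral_twistedM// (eq_integral (EFin \o omega q.+1))//.
  by rewrite [X in _ * X]kE -EFinM mulrC.
have mE (g h : posfun T R) : measurable_fun [set: T] (fun x => (g x / h x)%:E).
  apply/measurable_EFinP; apply: measurable_funM (measurable_posfunV _).
  exact: posfun_measurable.
have ge0E (g h : posfun T R) x : 0 <= (g x / h x)%:E.
  by rewrite lee_fin divr_ge0// ltW// posfun_gt0.
have [a a0 [aE intomega]] := integral_etahat_twisted hF omega qn.
have [b b0 [bE intpsi]] := integral_etahat_twisted hF psi qn.
(* The factor $w/s$ is isolated because integration against $\hat\eta_q^\psi$ brings out the weight
   [s], turning it into [w]. *)
have numE x : kint (fkM F q.+1) (omega q.+1) x ^+ 2 /
    (kint (fkM F q.+1) (psi q.+1) x * kint (fkM F q.+1) (rho q.+1) x) =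
    (w x / r x)%:E * (w x / s x)%:E.
  rewrite !kE expe2 -!EFinM inver mulf_eq0 !gt_eqF ?posfun_gt0//= -EFinM.
  by rewrite -/w -/r -/s invfM; congr (_%:E); ring.
have denE x : kint (fkM F q.+1) (omega q.+1) x /
    kint (fkM F q.+1) (psi q.+1) x = (w x / s x)%:E.
  by rewrite !kE inver gt_eqF ?posfun_gt0.
under eq_integral do rewrite ratE.
under [X in _ = X / _]eq_integral do rewrite numE.
under [X in _ = _ / X]eq_integral do rewrite denE.
rewrite intomega// intpsi//; last 2 first.
- by move=> x; rewrite mule_ge0.
- exact: emeasurable_funM.
rewrite intpsi//.
have sK x : (s x)%:E * (w x / s x)%:E = (w x)%:E.
  by rewrite -EFinM mulrC divfK// gt_eqF// posfun_gt0.
under [X in _ = _ / (_ * X)]eq_integral do rewrite sK.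
(* The integral left in the denominator is [a], and the factors $b^{-1}$ above and below cancel, so
   only $a^{-1}$ remains. *)
rewrite -aE -EFinM inver mulf_eq0 invr_eq0 !gt_eqF//= muleAC -EFinM.
congr (_ * _); last first.
  by apply: eq_integral => x _; rewrite muleCA sK muleC.
by rewrite invfM invrK mulrA mulVf ?mul1r// gt_eqF.
Qed.
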